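(* Let $p$ be a prime, $R=\mathbb{Z}/p^2\mathbb{Z}$, and $A\in R^{n\times n}$. Consider the Algorithm SNF-mod-$p^2$ described in the context, run on input $A$. Assume that all rank computations and all linear solves performed over the residue field return correct results and that the preconditioner in Step A5 succeeds (i.e. the leading block $B$ obtained there has $B\bmod p$ nonsingular). Then the algorithm returns the Smith multiplicities $(r_0,r_1,r_2)$ of $A$ modulo $p^2$.
   Context: Smith multiplicities: there are $U,V\in\mathrm{GL}_n(R)$ with $UAV=\mathrm{diag}(1^{r_0},p^{r_1},0^{r_2})$ (exponents denote the numbers of diagonal entries equal to $1$, $p$, $0$), and $(r_0,r_1,r_2)$ is uniquely determined by $A$. Rings: $\tilde R=\mathrm{GR}(p^2,d)$ is the unramified Galois ring extension of $R$ of degree $d\ge1$; it is local with maximal ideal $p\tilde R$, $p^2=0$, and residue field $F=\tilde R/p\tilde R\cong\mathbb{F}_{p^d}$ ($d=1$ gives $\tilde R=R$). Multiplication by $p$ induces an isomorphism $F=\tilde R/p\tilde R\to p\tilde R$, $\bar x\mapsto px$; for $z\in p\tilde R$, $z/p\bmod p$ denotes its preimage in $F$, and this is applied entrywise to matrices. For $T$ over $F$, $pT$ denotes the matrix over $\tilde R$ obtained by this isomorphism. A lift of a matrix over $F$ is any matrix over $\tilde R$ reducing to it modulo $p$. Here $\omega$ is a feasible exponent of dense matrix multiplication, $2<\omega\le 3$. Algorithm SNF-mod-$p^2$, on input $A\in R^{n\times n}$: A1. Choose an extension $\tilde R=\mathrm{GR}(p^2,d)$ if needed (so that $F$ is large enough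 for randomization) and regard $A$ as a matrix over $\tilde R$. A2. Compute $a=\mathrm{rank}_F(A\bmod p)$; set $r_0=a$, $k=n-a$. A3. If $k=0$, return $(n,0,0)$. A4. If $a=0$, then $A=pT$ with $T\in F^{n\times n}$; compute $r_1=\mathrm{rank}_F(A/p\bmod p)$ and return $(0,r_1,n-r_1)$. A5. Choose $P,Q\in\mathrm{GL}_n(\tilde R)$ such that, for $A'=PAQ=\begin{bmatrix} B & C \\ D & E \end{bmatrix}$ with $B\in\tilde R^{a\times a}$, the matrix $B_0=B\bmod p$ is nonsingular; verify this by computing $\mathrm{rank}_F(B_0)$, and resample $P,Q$ if the check reports failure. A6. Set the block size $t=\min\{a,k,\lceil n^{1/(\omega-1)}\rceil\}$. A7. Provide the map $X\mapsto TX$ for $X\in F^{k\times t}$, where $T=(E-DB^{-1}C)/p\bmod p$, by the following oracle: lift $X$ to $\widetilde X\in\tilde R^{k\times t}$; compute $U=C\widetilde X$ as the upper block of $A'\begin{bmatrix} 0 \\ \widetilde X \end{bmatrix}$; solve $BY=U$ over $\tilde R$ by Hensel lifting (solve $B_0Y_0=U\bmod p$ over $F$, lift $Y_0$ to $\widetilde Y_0$, put $W_1=(U-B\widetilde Y_0)/p\bmod p$, solve $B_0Y_1=W_1$ over $F$, lift $Y_1$ to $\widetilde Y_1$, set $Y=\widetilde Y_0+p\widetilde Y_1$); and return the lower block of $A'\begin{bmatrix} -Y \\ \widetilde X \end{bmatrix}$ divided by $p$, modulo $p$. A8. Compute $b=\mathrm{rank}_F(T)$, accessing $T$ only through the oracle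 of Step A7. A9. Return $(r_0,r_1,r_2)=(a,b,k-b)$. *)

(* Defs.v *)
From HB Require Import structures.
From mathcomp Require Import all_boot all_order all_algebra.
From mathcomp Require Import reals exp.

Set Implicit Arguments.
Unset Strict Implicit.
Unset Printing Implicit Defensive.

Import Order.TTheory GRing.Theory Num.Theory.
Local Open Scope ring_scope.

(* Since 'Z_m is Z/mZ only for m > 1, 'Z_(p ^ 2) is Z/p^2Z when p is prime.   *)

Definition smith_diag p n (r0 r1 : nat) : 'M['Z_(p ^ 2)]_n :=
  diag_mx (\row_(i < n) if (i < r0)%N then 1
                        else if (i < r0 + r1)%N then p%:R else 0).

Definition smith_multiplicities p n (A : 'M['Z_(p ^ 2)]_n)
    (r : nat * nat * nat) : Prop :=
  let: (r0, r1, r2) := r in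
  (r0 + r1 + r2 = n)%N /\
  exists U V : 'M['Z_(p ^ 2)]_n,
    [/\ U \in unitmx, V \in unitmx & U *m A *m V = smith_diag p n r0 r1].

(* GR(p^2, d): the finite local extension of Z/p^2Z with maximal ideal        *)
(* generated by p (gr_local says that the nonunits are the multiples of p)    *)
(* and with p^(2d) elements. The residue field then has p^d elements, and the *)
(* extension is free of rank d over Z/p^2Z.                                   *)
Record galois_ring (p d : nat) := GaloisRing {
  gr_sort :> finComUnitRingType;
  gr_emb : {rmorphism 'Z_(p ^ 2) -> gr_sort};
  gr_emb_inj : injective gr_emb;
  gr_local : forall x : gr_sort,
    x \isn't a GRing.unit <-> exists y : gr_sort, x = p%:R * y;
  gr_card : #|gr_sort| = (p ^ (2 * d))%N
}.

(* The residue field S / pS, given with its reduction map: a field that is a  *)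
(* surjective image of S with kernel pS.                                      *)
Record residue_field (p : nat) (S : comUnitRingType) := ResidueField {
  rf_sort :> fieldType;
  rf_red : {rmorphism S -> rf_sort};
  rf_surj : forall y : rf_sort, exists x : S, rf_red x = y;
  rf_ker : forall x : S, rf_red x = 0 <-> exists y : S, x = p%:R * y
}.

(* The external computations of the algorithm. [sub_bbrank] is the black-box  *)
(* rank: all it gets of a k x k matrix T is a procedure for X |-> T *m X on   *)
(* blocks X of t columns. [sub_lift i] performs the i-th lift of an oracle    *)
(* call; different lifts need not agree.                                      *)
Record subroutines (F : fieldType) (S : comUnitRingType) := Subroutines {
  sub_rank : forall n, 'M[F]_n -> nat;
  sub_solve : forall m t, 'M[F]_m -> 'M[F]_(m, t) -> 'M[F]_(m, t);
  sub_bbrank : forall k t, ('M[F]_(k, t) -> 'M[F]_(k, t)) -> nat;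
  sub_lift : nat -> forall m t, 'M[F]_(m, t) -> 'M[S]_(m, t)
}.

(* The last condition only says that [sub_lift i M] is a lift of M.           *)
Definition correct_subroutines p (S : comUnitRingType)
    (F : residue_field p S) (sub : subroutines F S) : Prop :=
  [/\ forall n (M : 'M[F]_n), sub_rank sub M = \rank M,
      forall m t (M : 'M[F]_m) (W : 'M[F]_(m, t)),
        M \in unitmx -> M *m sub_solve sub M W = W,
      forall k t (oracle : 'M[F]_(k, t) -> 'M[F]_(k, t)) (T : 'M[F]_k),
        (0 < t <= k)%N -> (forall X, oracle X = T *m X) ->
        sub_bbrank sub oracle = \rank T
    & forall i m t (M : 'M[F]_(m, t)),
        map_mx (rf_red F) (sub_lift sub i M) = M].

Definition block_size (K : realType) (omega : K) (n a k : nat) : nat :=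
  minn a (minn k `|Num.ceil (n%:R `^ (omega - 1)^-1)|%N).

Section Algorithm.

Variables (p d : nat) (S : galois_ring p d) (F : residue_field p S).
Variable sub : subroutines F S.

Let red m n (M : 'M[S]_(m, n)) : 'M[F]_(m, n) := map_mx (rf_red F) M.

(* z / p mod p; the result depends on z only, not on the chosen quotient y.   *)
Definition divp (z : S) : F :=
  if [pick y : S | z == p%:R * y] is Some y then rf_red F y else 0.

Let divp_mx m n (M : 'M[S]_(m, n)) : 'M[F]_(m, n) := map_mx divp M.

(* Here A' has blocks B, C, D, E, and the value is the product of             *)
(* (E - D B^-1 C) / p mod p with X.                                           *)
Definition schur_oracle a k t (A' : 'M[S]_(a + k)) (X : 'M[F]_(k, t)) :
    'M[F]_(k, t) :=
  let Xt : 'M[S]_(k, t) := sub_lift sub 0 X in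
  let B := ulsubmx A' in
  let U := usubmx (A' *m col_mx 0 Xt) in
  let Y0 := sub_lift sub 1 (sub_solve sub (red B) (red U)) in
  let W1 := divp_mx (U - B *m Y0) in
  let Y1 := sub_lift sub 2 (sub_solve sub (red B) W1) in
  let Y := Y0 + p%:R *: Y1 in
  divp_mx (dsubmx (A' *m col_mx (- Y) Xt)).

(* P A Q, with its size n written a + (n - a) in order to cut it into blocks; *)
(* for a <= n, conform_mx is a mere cast, and its default 0 is not used.      *)
Definition precond n (A : 'M[S]_n) (a : nat) (PQ : 'M[S]_n * 'M[S]_n) :
    'M[S]_(a + (n - a)) :=
  conform_mx 0 (PQ.1 *m A *m PQ.2).

Definition precond_lead n (A : 'M[S]_n) a PQ : 'M[F]_a :=
  red (ulsubmx (precond A a PQ)).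

(* [samples] lists the successive draws of (P, Q). The first one that passes  *)
(* the rank check is used; None means that no draw passes.                    *)
Definition snf_mod_p2 (K : realType) (omega : K) n
    (samples : seq ('M[S]_n * 'M[S]_n)) (A : 'M['Z_(p ^ 2)]_n) :
    option (nat * nat * nat) :=
  let At := map_mx (gr_emb S) A in
  let a := sub_rank sub (red At) in
  let k := (n - a)%N in
  if k == 0%N then Some (n, 0, 0)%N
  else if a == 0%N then
    let r1 := sub_rank sub (divp_mx At) in Some (0, r1, n - r1)%N
  else if ohead [seq PQ <- samples
                | sub_rank sub (precond_lead At a PQ) == a] is Some PQ then
    let t := block_size omega n a k in
    let b := sub_bbrank sub (@schur_oracle a k t (precond At a PQ)) in
    Some (a, b, k - b)%N
  else None.

(* The draws are in GL_n, and, whenever a preconditioner is needed, one of    *)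
(* them makes the leading block nonsingular modulo p.                         *)
Definition precond_succeeds n (samples : seq ('M[S]_n * 'M[S]_n))
    (A : 'M['Z_(p ^ 2)]_n) : Prop :=
  let At := map_mx (gr_emb S) A in
  let a := \rank (red At) in
  (forall PQ, PQ \in samples -> PQ.1 \in unitmx /\ PQ.2 \in unitmx) /\
  ((0 < a < n)%N ->
   exists2 PQ, PQ \in samples & precond_lead At a PQ \in unitmx).

End Algorithm.

(* Main.v *)
(* Any Smith form diag(1^r0, p^r1, 0^r2) of A yields one over GR(p^2, d), and *)
(* reduction modulo p gives rank (A mod p) = r0. Block elimination turns the  *)
(* preconditioned matrix into diag(B, G), with G the Schur complement, which  *)
(* is thus equivalent to diag(I, pH), with H = diag(1^r1, 0^r2). As B and I   *)
(* are invertible, the transition matrices are block triangular modulo p, so  *)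
(* G = pT with T and H equivalent modulo p, and rank (T mod p) = r1. Hence    *)
(* the algorithm returns every triple of Smith multiplicities of A, whence    *)
(* their uniqueness; existence comes from the Smith form of an integer lift.  *)

Require Import Defs.
From mathcomp Require Import all_boot all_order all_algebra.
From mathcomp Require Import reals exp.
Set Implicit Arguments.
Unset Strict Implicit.

Import Order.TTheory GRing.Theory Num.Theory.
Local Open Scope ring_scope.

(** Correctness and uniqueness come together: by [snf_mod_p2_smith] a run returns whichever Smith
    triple of A is given, so all triples equal its single output, and only existence
    ([smith_exists]) remains. Given a triple, reduction modulo p yields r0. For r1, preconditioning
    keeps the Smith form ([precond_smith]); the Schur complement of the leading block is then pT
    with T mod p of rank r1 ([schur_complement_smith]), and the oracle multiplies by T mod p
    ([schur_oracleE]). *)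

(** * Invertible matrices, ranks and initial segments *)

Lemma diag_mx_unit (R : comUnitRingType) n (u : 'rV[R]_n) :
  (forall i, u 0 i \is a GRing.unit) -> diag_mx u \in unitmx.
Proof.
move=> uP; rewrite unitmxE det_diag; apply: rpred_prod => i _; exact: uP.
Qed.

Lemma map_mx_unit (aR rR : comUnitRingType) (f : {rmorphism aR -> rR}) n
    (M : 'M[aR]_n) :
  M \in unitmx -> map_mx f M \in unitmx.
Proof. by rewrite !unitmxE det_map_mx; apply: rmorph_unit. Qed.

Lemma mxrank_mulr_unit (F : fieldType) m n (M : 'M[F]_(m, n)) (V : 'M[F]_n) :
  V \in unitmx -> \rank (M *m V) = \rank M.
Proof. by move=> uV; rewrite mxrankMfree // row_free_unit. Qed.

Lemma mxrank_mull_unit (F : fieldType) m n (U : 'M[F]_m) (M : 'M[F]_(m, n)) :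
  U \in unitmx -> \rank (U *m M) = \rank M.
Proof.
by move=> uU; rewrite -mxrank_tr trmx_mul mxrank_mulr_unit ?unitmx_tr ?mxrank_tr.
Qed.

(** Reads multiplicities off a divisibility chain, along which being a unit and being nonzero are
    both inherited by smaller indices. *)
Lemma prefix_pred (P : pred nat) n :
    (forall i j, (i <= j)%N -> P j -> P i) ->
  exists2 r, (r <= n)%N & forall i, (i < n)%N -> P i = (i < r)%N.
Proof.
move=> Pmono; elim: n => [|n [r le_rn Pr]]; first by exists 0.
case Pn: (P n).
  exists n.+1 => // i; rewrite ltnS => le_in.
  by rewrite (Pmono _ _ le_in Pn) le_in.
exists r => [|i]; first exact: leqW.
rewrite ltnS leq_eqVlt => /predU1P[-> | /Pr //].
by rewrite Pn ltnNge le_rn.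
Qed.

(** * Existence of Smith forms modulo p^2 *)

Section ModP2.

Variables (p : nat) (p_prime : prime p).

Let p2_gt1 : (1 < p ^ 2)%N.
Proof. by rewrite -(exp1n 2) ltn_exp2r // prime_gt1. Qed.

Lemma Zp2_pp : p%:R * p%:R = 0 :> 'Z_(p ^ 2).
Proof. by rewrite -natrM mulnn -Zp_nat_mod // modnn. Qed.

Lemma Zp2_p_neq0 : p%:R != 0 :> 'Z_(p ^ 2).
Proof.
rewrite -val_eqE /= val_Zp_nat // modn_small ?Zp_cast //.
  by rewrite -lt0n prime_gt0.
by rewrite -{1}(expn1 p) ltn_exp2l // prime_gt1.
Qed.

Lemma Zp2_nonunit (x : 'Z_(p ^ 2)) : x \isn't a GRing.unit -> x != 0 ->
  exists2 u, u \is a GRing.unit & x = u * p%:R.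
Proof.
rewrite -(natr_Zp x); move: (nat_of_ord x) => m.
have unitE k : (k%:R \is a @GRing.unit 'Z_(p ^ 2)) = ~~ (p %| k)%N.
  by rewrite unitZpE // coprime_pexpl // prime_coprime.
rewrite unitE negbK => /dvdnP[m' ->] nz.
exists m'%:R; last by rewrite natrM.
rewrite unitE; apply: contra nz => /dvdnP[m'' ->].
by rewrite !natrM -mulrA Zp2_pp mulr0.
Qed.

(** The Smith form of an integer lift, reduced modulo p^2, has a diagonal forming a divisibility
    chain: units first, then unit multiples of p, then zeros. A diagonal unit matrix W normalizes
    the entries. *)
Lemma smith_exists n (A : 'M['Z_(p ^ 2)]_n) :
  exists r, smith_multiplicities A r.
Proof.
pose f : {rmorphism int -> 'Z_(p ^ 2)} := intr.
have -> : A = map_mx f (map_mx (fun x : 'Z_(p ^ 2) => (x : nat)%:Z) A).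
  by apply/matrixP => i j; rewrite !mxE /= -pmulrn natr_Zp.
have [L uL [R uR [s s_sorted ->]]] :=
  int_Smith_normal_form (map_mx (fun x : 'Z_(p ^ 2) => (x : nat)%:Z) A).
rewrite !map_mxM; set D := map_mx f (\matrix_(i, j) _).
pose e i := f s`_i.
have DE : D = diag_mx (\row_(i < n) e i).
  by apply/matrixP => i j; rewrite !mxE; apply: (rmorphMn f).
have e_dvd i j : (i <= j)%N -> exists c, e j = c * e i.
  move=> le_ij; have : (s`_i %| s`_j)%Z.
    (* Past the end of s the default entry 0 is divisible by everything. *)
    have [lt_js|le_sj] := ltnP j (size s); last first.
      by rewrite (nth_default _ le_sj) dvdz0.
    apply: (sorted_leq_nth dvdz_trans dvdzz 0 s_sorted) => //.
    exact: leq_ltn_trans lt_js.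
  by case/dvdzP=> c Ec; exists (f c); rewrite /e Ec rmorphM.
have e_unit i j : (i <= j)%N -> e j \is a GRing.unit -> e i \is a GRing.unit.
  by move=> /e_dvd[c ->]; rewrite unitrM => /andP[].
have e_neq0 i j : (i <= j)%N -> e j != 0 -> e i != 0.
  by move=> /e_dvd[c ->]; apply: contraNneq => ->; rewrite mulr0.
have [r0 le_r0 r0P] := prefix_pred n e_unit.
have [r le_r rP] := prefix_pred n e_neq0.
have le_r0r : (r0 <= r)%N.
  case: r0 => // r0 in le_r0 r0P *.
  rewrite -rP //; have := r0P r0 le_r0; rewrite ltnSn.
  by apply: contraTneq => ->; rewrite unitr0.
have /fin_all_exists2[u uU uE] : forall i : 'I_n,
    exists2 u : 'Z_(p ^ 2), u \is a GRing.unit &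
    e i = u * (if (i < r0)%N then 1
               else if (i < r0 + (r - r0))%N then p%:R else 0).
  move=> i; rewrite subnKC // -r0P // -rP //.
  have [ui|nui] := boolP (e i \is a GRing.unit).
    by exists (e i); rewrite // mulr1.
  have [->|nz] := eqVneq (e i) 0; first by exists 1; rewrite ?unitr1 ?mulr0.
  exact: Zp2_nonunit.
exists (r0, r - r0, n - r)%N; split; first by rewrite subnKC ?subnKC.
pose W := diag_mx (\row_i u i).
have uW : W \in unitmx by apply: diag_mx_unit => i; rewrite mxE.
have uL' := map_mx_unit f uL; have uR' := map_mx_unit f uR.
exists (invmx W *m invmx (map_mx f L)), (invmx (map_mx f R)); split.
- by rewrite unitmx_mul !unitmx_inv uW.
- by rewrite unitmx_inv.
rewrite !mulmxA mulmxKV // -!mulmxA mulmxV // mulmx1.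
apply: (canLR (mulKmx uW)).
rewrite DE mulmx_diag; congr diag_mx; apply/rowP => i.
by rewrite !mxE uE.
Qed.

End ModP2.

(** * Reduction and division by p over the Galois ring *)

Section GaloisRing.

Variables (p : nat) (p_prime : prime p) (d : nat) (S : galois_ring p d).
Variable F : residue_field p S.

Let red m n (M : 'M[S]_(m, n)) : 'M[F]_(m, n) := map_mx (rf_red F) M.

Lemma gr_pp : p%:R * p%:R = 0 :> S.
Proof. by rewrite -!(rmorph_nat (gr_emb S)) -rmorphM Zp2_pp ?rmorph0. Qed.

Lemma gr_p_neq0 : p%:R != 0 :> S.
Proof.
apply: contra_neq (Zp2_p_neq0 p_prime) => p0.
by apply: (@gr_emb_inj _ _ S); rewrite rmorph_nat p0 rmorph0.
Qed.

Lemma unit_red (x : S) : (x \is a GRing.unit) = (rf_red F x != 0).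
Proof.
apply/idP/idP => [ux|]; first by rewrite -unitfE rmorph_unit.
by apply: contra_neqT => /gr_local/(rf_ker F).
Qed.

Lemma unitmx_red n (M : 'M[S]_n) : (red M \in unitmx) = (M \in unitmx).
Proof. by rewrite !unitmxE det_map_mx unitfE unit_red. Qed.

Lemma red_p : rf_red F p%:R = 0.
Proof. by apply/rf_ker; exists 1; rewrite mulr1. Qed.

Lemma redZp m n (M : 'M[S]_(m, n)) : red (p%:R *: M) = 0.
Proof. by rewrite /red map_mxZ red_p scale0r. Qed.

(** Otherwise x - y would be a unit killing p, although p is nonzero. Hence division by p is well
    defined modulo p. *)
Lemma red_mulp_inj (x y : S) : p%:R * x = p%:R * y -> rf_red F x = rf_red F y.
Proof.
move=> /eqP; rewrite -subr_eq0 -mulrBr => /eqP pz0.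
apply/eqP; rewrite -subr_eq0 -rmorphB; apply: contraNT gr_p_neq0.
by rewrite -unit_red => /mulrI inj; apply/eqP/inj; rewrite mulrC pz0 mulr0.
Qed.

Lemma divpM (y : S) : Defs.divp F (p%:R * y) = rf_red F y.
Proof.
rewrite /Defs.divp; case: pickP => [z /eqP /red_mulp_inj // | /(_ y)].
by rewrite eqxx.
Qed.

Lemma divp_mxZ m n (M : 'M[S]_(m, n)) : map_mx (Defs.divp F) (p%:R *: M) = red M.
Proof. by apply/matrixP => i j; rewrite !mxE divpM. Qed.

Lemma red_scalep_inj m n (M N : 'M[S]_(m, n)) :
  p%:R *: M = p%:R *: N -> red M = red N.
Proof. by rewrite -!divp_mxZ => ->. Qed.

Lemma red_eq_scalep m n (M N : 'M[S]_(m, n)) :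
  red M = red N -> p%:R *: M = p%:R *: N.
Proof.
move=> /matrixP eqMN; apply/matrixP => i j; have := eqMN i j; rewrite !mxE.
move=> /eqP; rewrite -subr_eq0 -rmorphB => /eqP/rf_ker[y def_y].
by apply/eqP; rewrite -subr_eq0 -mulrBr def_y mulrA gr_pp mul0r.
Qed.

Lemma red0_scalep m n (M : 'M[S]_(m, n)) :
  red M = 0 -> exists N, M = p%:R *: N.
Proof.
move=> /matrixP M0; exists (\matrix_(i, j) odflt 0 [pick y | M i j == p%:R * y]).
apply/matrixP => i j; rewrite !mxE; case: pickP => [y /eqP // | noy].
have /rf_ker[y def_y]: rf_red F (M i j) = 0 by have := M0 i j; rewrite !mxE.
by have := noy y; rewrite def_y eqxx.
Qed.

(** * Equivalence of block diagonal matrices and Schur complements *)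

(** With one transition matrix on each side, every block equation is short. The lower left one
    forces U21 = 0 modulo p, so U22 is invertible and p divides G; then the upper right one forces
    V12 = 0 modulo p, so V22 is invertible. Cancelling p in the last block leaves U22 T = H V22
    modulo p. *)
Lemma block_diag_equiv a k (B B' : 'M[S]_a) (G H : 'M[S]_k)
    (U V : 'M[S]_(a + k)) :
    B \in unitmx -> B' \in unitmx -> U \in unitmx -> V \in unitmx ->
    U *m block_mx B 0 0 G = block_mx B' 0 0 (p%:R *: H) *m V ->
  exists2 T, G = p%:R *: T & \rank (red T) = \rank (red H).
Proof.
move=> uB uB' uU uV.
rewrite -[U]submxK -[V]submxK in uU uV *.
set U11 := ulsubmx U; set U12 := ursubmx U; set U21 := dlsubmx U.
set U22 := drsubmx U; set V11 := ulsubmx V; set V12 := ursubmx V.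
set V21 := dlsubmx V; set V22 := drsubmx V.
rewrite !mulmx_block !mul0mx !mulmx0 !(addr0, add0r).
move=> /eq_block_mx[_ E12 E21 E22].
have U21_0 : red U21 = 0.
  apply: (can_inj (mulmxK (_ : red B \in unitmx))); first by rewrite unitmx_red.
  by rewrite -map_mxM E21 -scalemxAl [map_mx _ _]redZp mul0mx.
have uU22 : U22 \in unitmx.
  move: uU; rewrite -unitmx_red /red map_block_mx [map_mx _ U21]U21_0.
  by rewrite unitmxE det_ublock unitrM -!unitmxE !unitmx_red => /andP[].
have [T defG] : exists T, G = p%:R *: T.
  exists (invmx U22 *m (H *m V22)).
  by rewrite scalemxAr scalemxAl -E22 mulKmx.
exists T => //.
have V12_0 : red V12 = 0.
  apply: (can_inj (mulKmx (_ : red B' \in unitmx))); first by rewrite unitmx_red.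
  by rewrite -map_mxM -E12 defG -scalemxAr [map_mx _ _]redZp mulmx0.
have uV22 : V22 \in unitmx.
  move: uV; rewrite -unitmx_red /red map_block_mx [map_mx _ V12]V12_0.
  by rewrite unitmxE det_lblock unitrM -!unitmxE !unitmx_red => /andP[].
have : red (U22 *m T) = red (H *m V22).
  by apply: red_scalep_inj; rewrite scalemxAr -defG E22 scalemxAl.
rewrite /red !map_mxM => /(congr1 mxrank).
by rewrite mxrank_mull_unit ?mxrank_mulr_unit ?unitmx_red.
Qed.

Definition schur_complement a k (M : 'M[S]_(a + k)) : 'M[S]_k :=
  drsubmx M - dlsubmx M *m invmx (ulsubmx M) *m ursubmx M.

(** Block elimination M = L diag(B, G) R, with unipotent L and R absorbed into the transition
    matrices. *)
Lemma schur_complement_smith a k (M U V : 'M[S]_(a + k)) (H : 'M[S]_k) :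
    ulsubmx M \in unitmx -> U \in unitmx -> V \in unitmx ->
    U *m M *m V = block_mx 1%:M 0 0 (p%:R *: H) ->
  exists2 T, schur_complement M = p%:R *: T & \rank (red T) = \rank (red H).
Proof.
move=> uB uU uV defH.
set B := ulsubmx M in uB *; set C := ursubmx M; set D := dlsubmx M.
pose L : 'M_(a + k) := block_mx 1%:M 0 (D *m invmx B) 1%:M.
pose R : 'M_(a + k) := block_mx 1%:M (invmx B *m C) 0 1%:M.
have uL : L \in unitmx by rewrite unitmxE det_lblock !det1 mulr1 unitr1.
have uR : R \in unitmx by rewrite unitmxE det_ublock !det1 mulr1 unitr1.
have defM : M = L *m block_mx B 0 0 (schur_complement M) *m R.
  rewrite -[LHS]submxK !mulmx_block !(mul0mx, mulmx0, mul1mx, mulmx1).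
  rewrite !(addr0, add0r) mulmxKV // mulKVmx // mulmxA.
  by rewrite /schur_complement -/B -/C -/D addrC subrK.
apply: (@block_diag_equiv _ _ B 1%:M _ _ (U *m L) (invmx V *m invmx R));
  rewrite ?unitmx1 ?unitmx_mul ?unitmx_inv ?uU ?uV //.
by rewrite mulmxA -defH mulmxK // {2}defM !mulmxA mulmxK.
Qed.

(** * The Schur complement oracle *)

Variable (sub : subroutines F S).

(** Hensel lifting is exact: U - B Y0 = pW, and p B Y1 = pW since it depends only on B Y1 modulo p.
    As B is invertible, Y is B^-1 U whatever lifts were chosen, and the lower block is pT times a
    lift of X. *)
Lemma schur_oracleE a k t (M : 'M[S]_(a + k)) (T : 'M[S]_k) (X : 'M[F]_(k, t)) :
    correct_subroutines sub -> ulsubmx M \in unitmx ->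
    schur_complement M = p%:R *: T ->
  schur_oracle sub M X = red T *m X.
Proof.
move=> [_ solveP _ liftP] uB defT; rewrite /schur_oracle.
set Xt := sub_lift sub 0 X; set U := usubmx _.
set Y0 := sub_lift sub 1 _; set W1 := map_mx _ (U - _).
set Y1 := sub_lift sub 2 _.
set B := ulsubmx M in uB Y0 W1 Y1 *.
have uB0 : red B \in unitmx by rewrite unitmx_red.
have defU : U = ursubmx M *m Xt.
  by rewrite /U -{1}[M]submxK mul_block_col !mulmx0 !add0r col_mxKu.
have [W defW] : exists W, U - B *m Y0 = p%:R *: W.
  apply: red0_scalep; rewrite /red map_mxB map_mxM liftP solveP //.
  by rewrite subrr.
have BY1 : red (B *m Y1) = red W.
  by rewrite /red map_mxM liftP solveP // /W1 defW divp_mxZ.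
have -> : Y0 + p%:R *: Y1 = invmx B *m U.
  apply: (canRL (mulKmx uB)); rewrite mulmxDr -scalemxAr.
  by rewrite (red_eq_scalep BY1) -defW addrC subrK.
rewrite -[in LHS](submxK M) mul_block_col col_mxKd mulmxN defU !mulmxA addrC.
rewrite -mulmxBl -/(schur_complement M) defT -scalemxAl divp_mxZ.
by rewrite /red map_mxM liftP.
Qed.

(** * Smith forms over the Galois ring and preconditioning *)

Lemma map_smith_diag n r0 r1 : map_mx (gr_emb S) (smith_diag p n r0 r1) =
  diag_mx (\row_(i < n) if (i < r0)%N then 1
                        else if (i < r0 + r1)%N then p%:R else 0).
Proof.
rewrite map_diag_mx; congr diag_mx; apply/rowP => i; rewrite !mxE.
by do 2?case: ifP => _; rewrite ?rmorph1 ?rmorph_nat ?rmorph0.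
Qed.

Lemma red_smith_diag n r0 r1 :
  red (map_mx (gr_emb S) (smith_diag p n r0 r1)) = pid_mx r0.
Proof.
rewrite map_smith_diag; apply/matrixP => i j; rewrite !mxE rmorphMn /=.
rewrite (inj_eq val_inj); case: eqP => // _; case: ltnP => _ /=.
  by rewrite rmorph1.
by case: ifP => _; rewrite ?red_p ?rmorph0.
Qed.

Lemma smith_diag_scalep n r1 :
  map_mx (gr_emb S) (smith_diag p n 0 r1) = p%:R *: pid_mx r1.
Proof.
rewrite map_smith_diag; apply/matrixP => i j; rewrite !mxE /=.
rewrite (inj_eq val_inj).
by case: eqP => _; case: ifP => _; rewrite ?mulr1 ?mulr0.
Qed.

Lemma smith_diag_block a k r1 :
  map_mx (gr_emb S) (smith_diag p (a + k) a r1) =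
  block_mx 1%:M 0 0 (p%:R *: pid_mx r1).
Proof.
rewrite -smith_diag_scalep !map_smith_diag -diag_const_mx -diag_mx_row.
congr diag_mx; apply/rowP => i; rewrite !mxE.
case: splitP => j def_i; rewrite mxE //.
by rewrite def_i ltn_add2l.
Qed.

Lemma precond_smith n (M U V : 'M[S]_n) a r1 (PQ : 'M[S]_n * 'M[S]_n) :
    (a <= n)%N -> PQ.1 \in unitmx -> PQ.2 \in unitmx ->
    U \in unitmx -> V \in unitmx ->
    U *m M *m V = map_mx (gr_emb S) (smith_diag p n a r1) ->
  exists U' V', [/\ U' \in unitmx, V' \in unitmx &
    U' *m precond M a PQ *m V' = block_mx 1%:M 0 0 (p%:R *: pid_mx r1)].
Proof.
case: PQ => P Q /= le_an; rewrite /precond /=.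
(* Once n is literally a + k, [conform_mx] is the identity. *)
move: (n - a)%N (subnKC le_an) => k def_n; subst n => uP uQ uU uV defM.
exists (U *m invmx P), (invmx Q *m V).
rewrite !unitmx_mul !unitmx_inv uP uQ uU uV; split=> //.
by rewrite conform_mx_id -smith_diag_block -defM !mulmxA !mulmxKV // mulmxK.
Qed.

(** * Correctness of the algorithm *)

(** The range of block widths for which the black-box rank is specified. *)
Lemma block_size_bounds (K : realType) (omega : K) n a k :
  (0 < a)%N -> (0 < k)%N -> (0 < n)%N ->
  (0 < block_size omega n a k <= k)%N.
Proof.
move=> a0 k0 n0; rewrite /block_size !leq_min a0 k0 absz_gt0.
rewrite gt_eqF ?ceil_gt0 ?powR_gt0 ?ltr0n //=.
by rewrite (leq_trans (geq_minr _ _)) ?geq_minl.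
Qed.

Lemma snf_mod_p2_smith (K : realType) (omega : K) n
    (samples : seq ('M[S]_n * 'M[S]_n)) (A : 'M['Z_(p ^ 2)]_n) r :
    correct_subroutines sub -> precond_succeeds F samples A ->
    smith_multiplicities A r ->
  snf_mod_p2 sub omega samples A = Some r.
Proof.
move=> sub_correct; have [rankP _ bbrankP _] := sub_correct.
rewrite /precond_succeeds /snf_mod_p2 rankP; set At := map_mx _ A.
case: r => [[r0 r1] r2] [samples_unit samples_ok].
case=> def_n [U0 [V0 [uU0 uV0 defA]]].
have {defA} := congr1 (map_mx (gr_emb S)) defA; rewrite !map_mxM -/At.
have := map_mx_unit (gr_emb S) uU0; have := map_mx_unit (gr_emb S) uV0.
move: (map_mx _ U0) (map_mx _ V0) => U V uV uU defA {U0 V0 uU0 uV0}.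
have le_r0n : (r0 <= n)%N by rewrite -def_n -addnA leq_addr.
have rkA : \rank (red At) = r0.
  have := congr1 (fun M => \rank (red M)) defA.
  rewrite red_smith_diag rank_pid_mx // /red !map_mxM.
  by rewrite mxrank_mulr_unit ?mxrank_mull_unit ?unitmx_red.
rewrite [\rank _]rkA in samples_ok *; case: eqP => [k0|/eqP k_neq0].
  have r12 : (r1 + r2 = 0)%N by rewrite -k0 -def_n -addnA addKn.
  move/eqP: r12; rewrite addn_eq0 => /andP[/eqP r1_0 /eqP r2_0].
  by rewrite -def_n r1_0 r2_0 !addn0.
case: eqP => [a0 | /eqP a_neq0].
  rewrite rankP a0 in def_n defA *; rewrite smith_diag_scalep in defA.
  have defAt : At = p%:R *: (invmx U *m pid_mx r1 *m invmx V).
    by rewrite scalemxAl scalemxAr -defA -mulmxA mulKmx // mulmxK.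
  rewrite defAt divp_mxZ // /red !map_mxM map_pid_mx.
  rewrite mxrank_mulr_unit ?mxrank_mull_unit ?unitmx_red ?unitmx_inv //.
  rewrite rank_pid_mx -?def_n ?leq_addr //.
  by rewrite add0n addKn.
have n_gt_r0 : (r0 < n)%N by rewrite -subn_gt0 lt0n.
(* The draw guaranteed by [precond_succeeds] passes the rank check, so the filtered list is
   nonempty; the draw actually used may be another one. *)
case defPQ: (ohead _) => [PQ|]; last first.
  have [|PQ0 PQ0in uPQ0] := samples_ok; first by rewrite lt0n a_neq0.
  have : PQ0 \in [seq PQ <- samples |
                   sub_rank sub (precond_lead F At r0 PQ) == r0].
    by rewrite mem_filter rankP mxrank_unit ?eqxx.
  by case: (filter _ _) defPQ.
have : PQ \in [seq PQ <- samples |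
                sub_rank sub (precond_lead F At r0 PQ) == r0].
  by case: (filter _ _) defPQ => //= ? ? [->]; rewrite mem_head.
(* Passing the check means full rank modulo p, hence invertibility of B over the local ring. *)
rewrite mem_filter rankP -/(row_free _) row_free_unit [_ \in unitmx]unitmx_red //.
case/andP=> uB /samples_unit[uP uQ].
have [U' [V' [uU' uV' defM]]] := precond_smith le_r0n uP uQ uU uV defA.
have [T defT rkT] := schur_complement_smith uB uU' uV' defM.
have le_r1 : (r1 <= n - r0)%N by rewrite -def_n -addnA addKn leq_addr.
rewrite (bbrankP _ _ _ (red T)).
- rewrite rkT /red map_pid_mx rank_pid_mx //.
  by rewrite -{1}def_n -addnA !addKn.
- by rewrite block_size_bounds ?(leq_ltn_trans (leq0n _) n_gt_r0) ?lt0n.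
- by move=> X; apply: schur_oracleE.
Qed.

End GaloisRing.

Theorem theorem7p1 (p : nat) (p_prime : prime p)
    (n : nat) (A : 'M['Z_(p ^ 2)]_n)
    (d : nat) (d_gt0 : (0 < d)%N) (S : galois_ring p d)
    (F : residue_field p S)
    (K : realType) (omega : K) (omega_bounds : 2 < omega <= 3)
    (sub : subroutines F S) (sub_correct : correct_subroutines sub)
    (samples : seq ('M[S]_n * 'M[S]_n))
    (samples_ok : precond_succeeds F samples A) :
  exists r : nat * nat * nat,
    snf_mod_p2 sub omega samples A = Some r /\
    unique (smith_multiplicities A) r.
Proof.
have snfP r := snf_mod_p2_smith p_prime omega sub_correct samples_ok (r := r).
have [r Ar] := smith_exists p_prime A; exists r; split; first exact: snfP.
by split=> // r' /snfP; rewrite (snfP r Ar) => -[].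
Qed.
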